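(* Let $q\ge 3$ be a power of a prime $p$. Each point of the DGZ curve lying in $PG(2,\mathbb{F}_{q^2})\setminus PG(2,\mathbb{F}_q)$ is the center of a unique branch of the DGZ curve. Furthermore, such a branch has order $q-1$, and its intersection number with its tangent is $q$.
   Context: Put $D_1(x,y,z)=\begin{vmatrix} x & x^q & x^{q^3}\\ y & y^q & y^{q^3}\\ z & z^q & z^{q^3}\end{vmatrix}$, $D_2(x,y,z)=\begin{vmatrix} x & x^q & x^{q^2}\\ y & y^q & y^{q^2}\\ z & z^q & z^{q^2}\end{vmatrix}$ and $F=D_1/D_2$, which is a homogeneous polynomial of degree $q^3-q^2$ over $\mathbb{F}_q$. The DGZ curve is the plane curve over $\mathbb{K}=\overline{\mathbb{F}}_q$ with equation $F(x,y,z)=0$. In an affine chart, a branch of a plane curve $f(x,y)=0$ centred at the point $(a,b)$ is given by a primitive representation $(x(t),y(t))$ with $x(t),y(t)\in\mathbb{K}[[t]]$, not both constant, $x(0)=a$, $y(0)=b$, $f(x(t),y(t))=0$, taken up to reparametrization ($t\mapsto$ a power series of order one); primitive means not obtained from another representation by substituting a power series of order at least $2$ (nor by $t\mapsto t^m$, $m\geq 2$). The order of the branch is $\min\{\mathrm{ord}_t(x(t)-a),\mathrm{ord}_t(y(t)-b)\}$. The intersection number of the branch with a line $ux+vy+w=0$ is $\mathrm{ord}_t(ux(t)+vy(t)+w)$, and the tangent of the branch is the unique line through $(a,b)$ whose intersection number with the branch exceeds the order of the branch. *)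

(* Defs.v *)
From HB Require Import structures.
From mathcomp Require Import all_boot all_order all_algebra finfield.
From mathcomp Require Import boolp.
From mathcomp.multinomials Require Import mpoly.

Set Implicit Arguments.
Unset Strict Implicit.
Unset Printing Implicit Defensive.

Import GRing.Theory.
Local Open Scope ring_scope.

(** * The ring K[[t]] of formal power series in one variable *)

Record fps (K : nzRingType) := FPS { fps_coef : nat -> K }.

Section FpsZmodule.
Variable K : nzRingType.

HB.instance Definition _ := [isNew for @fps_coef K].
HB.instance Definition _ := [Choice of fps K by <:].

Lemma fpsP (f g : fps K) : fps_coef f =1 fps_coef g -> f = g.
Proof. by case: f g => [f] [g] /= /funext ->. Qed.

Definition fps_zero : fps K := FPS (fun=> 0).
Definition fps_opp (f : fps K) := FPS (fun n => - fps_coef f n).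
Definition fps_add (f g : fps K) := FPS (fun n => fps_coef f n + fps_coef g n).

Fact fps_addA : associative fps_add.
Proof. by move=> f g h; apply/fpsP => n; apply: addrA. Qed.
Fact fps_addC : commutative fps_add.
Proof. by move=> f g; apply/fpsP => n; apply: addrC. Qed.
Fact fps_add0 : left_id fps_zero fps_add.
Proof. by move=> f; apply/fpsP => n; apply: add0r. Qed.
Fact fps_addN : left_inverse fps_zero fps_opp fps_add.
Proof. by move=> f; apply/fpsP => n; apply: addNr. Qed.

HB.instance Definition _ :=
  GRing.isZmodule.Build (fps K) fps_addA fps_addC fps_add0 fps_addN.

End FpsZmodule.

Section FpsRing.
Variable K : comNzRingType.
Implicit Types f g h : fps K.

Definition fpsC (c : K) : fps K := FPS (fun n => if n == 0%N then c else 0).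
Definition fps_mul f g : fps K :=
  FPS (fun n => \sum_(i < n.+1) fps_coef f i * fps_coef g (n - i)).

Let tr m f : {poly K} := \poly_(i < m.+1) fps_coef f i.

Let coef_tr m f n : (n <= m)%N -> (tr m f)`_n = fps_coef f n.
Proof. by move=> le_nm; rewrite coef_poly ltnS le_nm. Qed.

Let coef_trM m f g n :
  (n <= m)%N -> (tr m f * tr m g)`_n = fps_coef (fps_mul f g) n.
Proof.
move=> le_nm; rewrite coefM; apply: eq_bigr => i _.
by rewrite !coef_tr // (leq_trans _ le_nm) ?leq_subr // -ltnS.
Qed.

Fact fps_mulC : commutative fps_mul.
Proof. by move=> f g; apply/fpsP => n; rewrite -!(@coef_trM n) // mulrC. Qed.

Fact fps_mulA : associative fps_mul.
Proof.
move=> f g h; apply/fpsP => n.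
transitivity (tr n f * (tr n g * tr n h))`_n.
  rewrite coefM; apply: eq_bigr => i _.
  by rewrite (coef_tr f) -1?ltnS // coef_trM // leq_subr.
rewrite mulrA coefM; apply: eq_bigr => i _.
by rewrite (coef_tr h) ?leq_subr // coef_trM // -ltnS.
Qed.

Fact fps_mul1 : left_id (fpsC 1) fps_mul.
Proof.
move=> f; apply/fpsP => n /=.
by rewrite big_ord_recl /= mul1r subn0 big1 ?addr0 // => i _; rewrite mul0r.
Qed.

Fact fps_mulDl : left_distributive fps_mul (@fps_add K).
Proof.
move=> f g h; apply/fpsP => n /=.
by rewrite -big_split; apply: eq_bigr => i _; rewrite /= mulrDl.
Qed.

Fact fps_oner_neq0 : fpsC 1 != fps_zero K.
Proof.
by apply/eqP => /(congr1 (fun f => fps_coef f 0)) /eqP; rewrite oner_eq0.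
Qed.

HB.instance Definition _ := GRing.Zmodule_isComNzRing.Build (fps K)
  fps_mulA fps_mulC fps_mul1 fps_mulDl fps_oner_neq0.

Fact fpsC_is_zmod_morphism : zmod_morphism fpsC.
Proof. by move=> a b; apply/fpsP => -[|n] //=; rewrite subr0. Qed.

Fact fpsC_is_monoid_morphism : monoid_morphism fpsC.
Proof.
split=> // a b; apply/fpsP => n.
rewrite [fpsC a * _]/(fps_mul _ _) /= big_ord_recl /= subn0.
rewrite big1 ?addr0 => [|i _]; last by rewrite mul0r.
by case: n => //=; rewrite mulr0.
Qed.

HB.instance Definition _ :=
  GRing.isZmodMorphism.Build K (fps K) fpsC fpsC_is_zmod_morphism.
HB.instance Definition _ :=
  GRing.isMonoidMorphism.Build K (fps K) fpsC fpsC_is_monoid_morphism.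

(* Substitution f(s(t)): when s has zero constant term, s ^+ i has order at
   least i, so that only the terms with i <= n contribute to coefficient n.
   The value is meaningless if s has a nonzero constant term. *)
Definition fps_comp f s : fps K :=
  FPS (fun n => \sum_(i < n.+1) fps_coef f i * fps_coef (s ^+ i) n).

(* Orders live in nat + {oo}, with None standing for oo = ord_t 0. *)
Definition fps_ord f : option nat :=
  if pselect (exists n, fps_coef f n != 0) is left ex_n
  then Some (ex_minn ex_n) else None.

Definition ole (m n : option nat) : bool :=
  match m, n with
  | _, None => true
  | None, Some _ => false
  | Some m, Some n => (m <= n)%N
  end.
Definition olt m n := ~~ ole n m.
Definition omin m n := if ole m n then m else n.

End FpsRing.

(** * Branches of an affine plane curve f = 0

    Affine points are maps a : 'I_2 -> K, and the pair (x(t), y(t)) is a map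
    r : 'I_2 -> fps K. *)

Section Branch.
Variable K : fieldType.
Implicit Types (f : {mpoly K[2]}) (a : 'I_2 -> K) (r : 'I_2 -> fps K).
Implicit Types (s : fps K) (l : K * K * K).

Definition series_eval f r : fps K := mmap (@fpsC K) r f.

Definition representation f a r : Prop :=
  [/\ exists k, forall c, r k <> fpsC c,
      forall k, fps_coef (r k) 0 = a k
    & series_eval f r = 0].

Definition substitution r s : 'I_2 -> fps K := fun k => fps_comp (r k) s.

Definition primitive_representation f a r : Prop :=
  representation f a r /\
  forall r' s, representation f a r' -> ole (Some 2) (fps_ord s) ->
    ~ (r =1 substitution r' s).

(* The equivalence relation whose classes of primitive representations are
   the branches. *)
Definition same_branch r r' : Prop :=
  exists2 s, fps_ord s = Some 1 & r' =1 substitution r s.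

Definition branch_order a r : option nat :=
  omin (fps_ord (r 0 - fpsC (a 0))) (fps_ord (r 1 - fpsC (a 1))).

(* The triple (u, v, w) stands for the line ux + vy + w = 0. *)
Definition is_line l : Prop := (l.1.1 != 0) || (l.1.2 != 0).
Definition same_line l l' : Prop :=
  exists2 c, c != 0 & l' = (c * l.1.1, c * l.1.2, c * l.2).
Definition on_line l a : Prop := l.1.1 * a 0 + l.1.2 * a 1 + l.2 = 0.

Definition intersection_number r l : option nat :=
  fps_ord (fpsC l.1.1 * r 0 + fpsC l.1.2 * r 1 + fpsC l.2).

Definition exceeds_order a r l : Prop :=
  [/\ is_line l, on_line l a
    & olt (branch_order a r) (intersection_number r l)].

Definition tangent a r l : Prop :=
  exceeds_order a r l /\ forall l', exceeds_order a r l' -> same_line l l'.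

End Branch.

(** * The projective plane *)

Section Plane.
Variable K : fieldType.

(* The point with homogeneous coordinates P lies in PG(2, L), where L is
   seen as a subfield of K through j. *)
Definition in_PG2 (L : fieldType) (j : {rmorphism L -> K}) (P : 'rV[K]_3) :
  Prop :=
  exists2 v : 'rV[L]_3, v != 0 &
    exists2 c : K, c != 0 & P = c *: map_mx j v.

(* The affine chart where the i-th homogeneous coordinate is nonzero; the two
   affine coordinates are the remaining ones divided by the i-th one. *)
Definition chart_point (i : 'I_3) (P : 'rV[K]_3) : 'I_2 -> K :=
  fun k => P 0 (lift i k) / P 0 i.
Definition chart_poly (i : 'I_3) (F : {mpoly K[3]}) : {mpoly K[2]} :=
  F \mPo [tuple if unlift i j is Some k then 'X_k else 1 | j < 3].

End Plane.

(** * The DGZ curve *)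

Section DGZ.
Variables (K : fieldType) (q : nat).

Definition dgz_D1 : {mpoly K[3]} :=
  \det (\matrix_(i < 3, j < 3) 'X_i ^+ (q ^ nth 0%N [:: 0; 1; 3] j)%N).
Definition dgz_D2 : {mpoly K[3]} :=
  \det (\matrix_(i < 3, j < 3) 'X_i ^+ (q ^ nth 0%N [:: 0; 1; 2] j)%N).

Definition is_dgz_poly (F : {mpoly K[3]}) : Prop := dgz_D1 = F * dgz_D2.

End DGZ.

(* D1 is divisible by D2, with a unique quotient F: up to sign, F is the
   coefficient of T^(q^2) in the product of the T - (a x + b y + c z), for
   a, b, c in F_q. *)
Section DGZQuotient.
Variables (p h q : nat) (L : finFieldType) (K : fieldType).
Variable j : {rmorphism L -> K}.
Hypotheses (pr_p : prime p) (def_q : q = (p ^ h)%N) (cardL : #|L| = q).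

Let R := {mpoly K[3]}.
Let A (t : R) : 'M[R]_4 :=
  \matrix_(i, m) (if unlift ord_max i is Some k then 'X_k else t) ^+ (q ^ m).
Let c m := cofactor (A 0) ord_max m.
Let v (a : {ffun 'I_3 -> L}) : R := \sum_k (j (a k))%:MP * 'X_k.

Let q_gt1 : (1 < q)%N. Proof. by rewrite -cardL finNzRing_gt1. Qed.

Let cE t m : cofactor (A t) ord_max m = c m.
Proof.
rewrite /c /cofactor; congr (_ * \det _); apply/matrixP => i k.
by rewrite !mxE liftK.
Qed.

Let Q : {poly R} := \sum_m c m *: 'X^(q ^ m).

Let QE t : Q.[t] = \det (A t).
Proof.
rewrite (expand_det_row _ ord_max) horner_sum; apply: eq_bigr => m _.
by rewrite hornerZ hornerXn cE mxE unlift_none mulrC.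
Qed.

Let frobL (x : L) m : x ^+ (q ^ m) = x.
Proof.
elim: m => [|m IHm]; first by rewrite expr1.
by rewrite expnSr exprM IHm -cardL expf_card.
Qed.

Let vX a m : v a ^+ (q ^ m) = \sum_k (j (a k))%:MP * 'X_k ^+ (q ^ m).
Proof.
have pL : p \in [pchar L] by apply: (card_finPcharP _ pr_p); rewrite cardL def_q.
have pR : p \in [pchar R].
  exact: (rmorph_pchar (@mpolyC 3 K)) (rmorph_pchar j pL).
have qR : [pchar R].-nat (q ^ m)%N.
  rewrite (eq_pnat _ (pcharf_eq pR)) def_q -expnM.
  by rewrite pnatX pnat_id.
rewrite /v !big_ord_recl !big_ord0 !addr0 !(exprDn_pchar _ _ qR) !exprMn.
by rewrite -!rmorphXn /= !frobL.
Qed.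

Let rootQ a : root Q (v a).
Proof.
rewrite rootE QE; apply/det0P.
exists (\row_i (if unlift ord_max i is Some k then - (j (a k))%:MP else 1)).
  apply/eqP => /rowP/(_ ord_max)/eqP; rewrite !mxE unlift_none.
  by rewrite oner_eq0.
apply/rowP => m; rewrite !mxE big_ord_recr /= !mxE unlift_none mul1r vX.
rewrite -big_split big1 // => i _ /=; rewrite !mxE.
have ->: widen_ord (leqnSn 3) i = lift ord_max i by apply/val_inj; rewrite [RHS]lift_max.
by rewrite liftK mulNr addNr.
Qed.

Let v_inj : injective v.
Proof.
move=> a b /(congr1 (fun P : R => fun k => P@_U_(k))) eq_ab.
apply/ffunP => k; apply: (fmorph_inj j).
have vk f : (v f)@_U_(k) = j (f k).
  rewrite /v raddf_sum (bigD1 k) //= mcoeffCM mcoeffX eqxx mulr1 big1 ?addr0 //.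
  move=> i ne_ik; rewrite mcoeffCM mcoeffX.
  by rewrite eq_mnm1 (negPf ne_ik) mulr0.
by have := congr1 (@^~ k) eq_ab; rewrite /= !vk.
Qed.

Let P : {poly R} := \prod_(a <- enum {ffun 'I_3 -> L}) ('X - (v a)%:P).

Let QP : Q = c ord_max *: P.
Proof.
have szP : size P = (q ^ 3).+1.
  by rewrite /P size_prod_XsubC -cardT card_ffun card_ord cardL.
have lead : P`_(q ^ 3) = 1.
  have /monicP := monic_prod_XsubC (enum {ffun 'I_3 -> L}) predT v.
  by rewrite -/P lead_coefE szP.
apply/eqP; rewrite -subr_eq0; apply/eqP.
apply: (@roots_geq_poly_eq0 _ _ [seq v a | a : {ffun 'I_3 -> L}]).
- apply/allP => _ /mapP[a _ ->]; rewrite rootE hornerD hornerN hornerZ.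
  rewrite (eqP (rootQ a)) sub0r oppr_eq0 mulf_eq0; apply/orP; right.
  by rewrite horner_prod (bigD1_seq a) ?mem_enum ?enum_uniq //= hornerXsubC subrr mul0r.
- by rewrite map_inj_uniq ?enum_uniq.
- rewrite size_map -cardT card_ffun card_ord cardL.
  apply/leq_sizeP => k; rewrite leq_eqVlt => /predU1P[<-|lt_k].
    rewrite coefB coefZ lead mulr1 coef_sum big_ord_recr /= coefZ coefXn eqxx.
    rewrite mulr1 big1 ?add0r ?subrr // => i _; rewrite coefZ coefXn eqn_exp2l //.
    by rewrite gtn_eqF ?mulr0 //= ltn_ord.
  rewrite coefB coefZ (nth_default 0 (_ : size P <= k)%N) ?szP // mulr0 subr0.
  rewrite coef_sum big1 // => i _; rewrite coefZ coefXn gtn_eqF ?mulr0 //.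
  by rewrite (leq_ltn_trans _ lt_k) // leq_exp2l // -ltnS.
Qed.

Lemma dgz_poly_exists : exists F : {mpoly K[3]}, is_dgz_poly q F.
Proof.
exists (- P`_(q ^ 2)); rewrite /is_dgz_poly.
have c3 : c ord_max = dgz_D2 K q.
  rewrite /c /cofactor addnn -signr_odd odd_double mul1r /dgz_D2.
  congr (\det _); apply/matrixP => i k; rewrite !mxE liftK lift_max.
  by case: k => -[|[|[|]]].
pose o2 : 'I_4 := Ordinal (isT : 2 < 4)%N.
have c2 : c o2 = - dgz_D1 K q.
  rewrite /c /cofactor -signr_odd /= mulN1r /dgz_D1.
  congr (- \det _); apply/matrixP => i k; rewrite !mxE liftK.
  by case: k => -[|[|[|]]].
have : Q`_(q ^ 2) = c o2.
  rewrite coef_sum (bigD1 o2) //= coefZ coefXn eqxx mulr1 big1 ?addr0 // => i ne_i2.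
  by rewrite coefZ coefXn eqn_exp2l // eq_sym (negPf (_ : i != 2 :> nat)) ?mulr0.
rewrite QP coefZ c3 c2 => /(congr1 -%R); rewrite opprK => <-.
by rewrite mulNr mulrC.
Qed.

Lemma dgz_D2_neq0 : dgz_D2 K q != 0.
Proof.
pose x (i : 'I_3) : {poly K} := 'X^i.
suff: mmap (@polyC K) x (dgz_D2 K q) != 0.
  by apply: contraNneq => ->; rewrite raddf0.
pose a : 'rV[{poly K}]_3 := \row_(k < 3) 'X^(q ^ k).
have -> : mmap (@polyC K) x (dgz_D2 K q) = \det (Vandermonde 3 a).
  rewrite -det_map_mx /=; congr (\det _); apply/matrixP => i k; rewrite !mxE.
  rewrite rmorphXn /= mmapX mmap1U /x -!exprM mulnC; congr ('X^(_ * _)).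
  by case: k => -[|[|[|]]].
rewrite det_Vandermonde; apply/prodf_neq0 => i _; apply/prodf_neq0 => k lt_ik.
rewrite !mxE subr_eq0; apply/negP => /eqP/(congr1 (fun f : {poly K} => size f)).
by rewrite !size_polyXn => -[] /eqP; rewrite eqn_exp2l // gtn_eqF.
Qed.

Lemma dgz_poly_unique (F G : {mpoly K[3]}) :
  is_dgz_poly q F -> is_dgz_poly q G -> F = G.
Proof.
rewrite /is_dgz_poly => -> /(mulIf _); apply; exact: dgz_D2_neq0.
Qed.

End DGZQuotient.

(* Main.v *)
(* In an affine chart with coordinates (x, y) put A = x^q - x and B = y^q - y; the
   quotient D_1/D_2 is 1 + (A B^(q^2) - A^(q^2) B) / (A B^q - A^q B). Replacing
   (A, B) by independent F_q-linear combinations (X, Y) multiplies numerator and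
   denominator by the same constant, so the quotient is unchanged. With
   U = X^(q-1) and V = Y^(q-1) it equals 1 + U^q + V (V - U)^(q-1).
   A point of PG(2, q^2) outside PG(2, q) lies on a unique line over F_q, and
   we take Y to come from the equation eta of that line and X from a transversal
   coordinate xi, both centred at the point: then Y = eta^q - eta and
   X = xi^q - xi + c with c^q = -c <> 0. The equation of the curve becomes
   xi^q (1 - xi^(q^3-q)) = eta^(q-1) B with B a unit. So ord eta > ord xi, and
   after the blow-up eta = xi w it reads xi = xi^(q^3-q+1) + w^(q-1) B, a
   contraction for the t-adic metric. Hence xi is a power series phi(w) of order
   q - 1, every representation is (phi, w phi) composed with w, and the only
   branch is given by w = t: it has orders q - 1 along xi and q along eta. *)

Require Import Defs.
From HB Require Import structures.
From mathcomp Require Import all_boot all_order all_algebra finfield zify ring.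
From mathcomp.multinomials Require Import mpoly.

Set Implicit Arguments.
Unset Strict Implicit.
Unset Printing Implicit Defensive.

Import GRing.Theory.
Local Open Scope ring_scope.

(** * Power series: t-adic topology, composition, orders *)

Section Vanishing.
Variable K : comNzRingType.
Implicit Types f g s : fps K.

(** Membership in the ideal of t^n, so that [vanish n (f - g)] is congruence modulo t^n. The zero
    series needs no separate treatment. *)
Definition vanish n f : Prop := forall m, (m < n)%N -> fps_coef f m = 0.

Lemma fps_coefM f g n :
  fps_coef (f * g) n = \sum_(i < n.+1) fps_coef f i * fps_coef g (n - i).
Proof. by []. Qed.

Lemma fps_coefD f g n : fps_coef (f + g) n = fps_coef f n + fps_coef g n.
Proof. by []. Qed.

Lemma fps_coefB f g n : fps_coef (f - g) n = fps_coef f n - fps_coef g n.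
Proof. by []. Qed.

Lemma fps_coefN f n : fps_coef (- f) n = - fps_coef f n.
Proof. by []. Qed.

Lemma fps_coef_sum (I : Type) (r : seq I) (P : pred I) (F : I -> fps K) n :
  fps_coef (\sum_(i <- r | P i) F i) n = \sum_(i <- r | P i) fps_coef (F i) n.
Proof. by elim/big_rec2: _ => // i x y _ <-. Qed.

Lemma fps_coefCM c f n : fps_coef (fpsC c * f) n = c * fps_coef f n.
Proof.
rewrite fps_coefM big_ord_recl /= subn0 big1 ?addr0 // => i _.
by rewrite mul0r.
Qed.

Lemma fps_coef0M f g : fps_coef (f * g) 0 = fps_coef f 0 * fps_coef g 0.
Proof. by rewrite fps_coefM big_ord1 subnn. Qed.

Lemma fps_coef0X f n : fps_coef (f ^+ n) 0 = fps_coef f 0 ^+ n.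
Proof. by elim: n => [|n IHn]; rewrite // !exprS fps_coef0M IHn. Qed.

Lemma vanish0n f : vanish 0 f.
Proof. by move=> m; rewrite ltn0. Qed.

Lemma vanishn0 n : vanish n 0.
Proof. by move=> m. Qed.

Lemma vanish1 f : fps_coef f 0 = 0 -> vanish 1 f.
Proof. by move=> f0 [|m]. Qed.

Lemma vanishW m n f : (n <= m)%N -> vanish m f -> vanish n f.
Proof. by move=> le_nm fm k lt_kn; apply: fm; apply: leq_trans lt_kn le_nm. Qed.

Lemma vanishD n f g : vanish n f -> vanish n g -> vanish n (f + g).
Proof. by move=> fn gn m lt_mn; rewrite fps_coefD fn ?gn ?addr0. Qed.

Lemma vanishB n f g : vanish n f -> vanish n g -> vanish n (f - g).
Proof. by move=> fn gn m lt_mn; rewrite fps_coefB fn ?gn ?subr0. Qed.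

Lemma vanishN n f : vanish n f -> vanish n (- f).
Proof. by move=> fn m lt_mn; rewrite fps_coefN fn ?oppr0. Qed.

Lemma vanish_subC n f g : vanish n (f - g) -> vanish n (g - f).
Proof. by move=> /vanishN; rewrite opprB. Qed.

Lemma vanishM m n f g : vanish m f -> vanish n g -> vanish (m + n) (f * g).
Proof.
move=> fm gn k lt_k; rewrite fps_coefM big1 // => i _.
have [lt_im | le_mi] := ltnP i m; first by rewrite fm ?mul0r.
by rewrite gn ?mulr0 //; case: i le_mi => /= i; lia.
Qed.

Lemma vanishMr n f g : vanish n f -> vanish n (f * g).
Proof. by move=> fn; rewrite -[n]addn0; apply: vanishM. Qed.

Lemma vanishMl n f g : vanish n g -> vanish n (f * g).
Proof. by move=> gn; rewrite mulrC; apply: vanishMr. Qed.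

Lemma vanishX n k f : vanish n f -> vanish (k * n) (f ^+ k).
Proof.
move=> fn; elim: k => [|k IHk]; [exact: vanish0n | rewrite exprS mulSn; exact: vanishM].
Qed.

Lemma vanish_mul_sub n f f' g g' :
  vanish n (f - f') -> vanish n (g - g') -> vanish n (f * g - f' * g').
Proof.
move=> ff gg; have ->: f * g - f' * g' = (f - f') * g + f' * (g - g').
  by rewrite mulrBl mulrBr addrA subrK.
by apply: vanishD; [apply: vanishMr | apply: vanishMl].
Qed.

Lemma vanish_exp_sub n k f f' : vanish n (f - f') -> vanish n (f ^+ k - f' ^+ k).
Proof. by move=> ff; rewrite subrXX; apply: vanishMr. Qed.

Lemma vanish_add_sub n f f' g g' :
  vanish n (f - f') -> vanish n (g - g') -> vanish n ((f + g) - (f' + g')).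
Proof. by move=> ff gg; rewrite opprD addrACA; apply: vanishD. Qed.

Lemma vanish_opp_sub n f f' : vanish n (f - f') -> vanish n (- f - - f').
Proof. by rewrite -opprD => /vanishN. Qed.

Lemma eq_fps_vanish f g : (forall n, vanish n (f - g)) -> f = g.
Proof.
move=> fg; apply/fpsP => n; apply/eqP; rewrite -subr_eq0 -fps_coefB.
by rewrite (fg n.+1).
Qed.

Lemma fps_coefM_vanish m n f g : vanish m f -> vanish n g ->
  fps_coef (f * g) (m + n) = fps_coef f m * fps_coef g n.
Proof.
move=> fm gn; rewrite fps_coefM.
have lt_m : (m < (m + n).+1)%N by rewrite ltnS leq_addr.
rewrite (bigD1 (Ordinal lt_m)) //= addKn big1 ?addr0 // => i ne_im.
have [lt_im | le_mi] := ltnP i m; first by rewrite fm ?mul0r.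
rewrite gn ?mulr0 //; have : i != m :> nat.
  by apply: contraNneq ne_im => im; apply/eqP/val_inj.
by case: i le_mi {ne_im} => /= i; lia.
Qed.

(* Banach's fixed point theorem for the t-adic metric. *)
Lemma contraction_fixpoint (T : fps K -> fps K) :
    (forall f, vanish 1 f -> vanish 1 (T f)) ->
    (forall n f g, vanish 1 f -> vanish 1 g ->
       vanish n (f - g) -> vanish n.+1 (T f - T g)) ->
  exists2 f, vanish 1 f & T f = f.
Proof.
move=> T1 TB; pose g n := iter n T 0.
have g1 n : vanish 1 (g n) by elim: n => [|n IHn]; [apply: vanishn0 | apply: T1].
have gS n : vanish n (g n.+1 - g n).
  by elim: n => [|n IHn]; [apply: vanish0n | apply: (TB n (g n.+1) (g n))].
have gD k n : vanish n (g (k + n)%N - g n).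
  elim: k => [|k IHk]; first by rewrite subrr; apply: vanishn0.
  rewrite addSn -(subrK (g (k + n)%N) (g _.+1)) -addrA; apply: vanishD => //.
  by apply: (vanishW _ (gS _)); rewrite leq_addl.
(* All iterates from [g n.+1] on agree modulo t^(n+1), so coefficient n of the limit is read off
   there. *)
pose f := FPS (fun n => fps_coef (g n.+1) n).
have fg n : vanish n (f - g n).
  move=> m lt_mn; rewrite fps_coefB /= -(subnK lt_mn).
  have := gD (n - m.+1)%N m.+1 m (ltnSn m); rewrite fps_coefB.
  by move/eqP; rewrite subr_eq0 => /eqP ->; rewrite subrr.
have f1 : vanish 1 f by apply: vanish1; apply: (g1 1).
exists f => //; apply: eq_fps_vanish => n.
rewrite -(subrK (g n.+1) (T f)) -addrA; apply: vanishD.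
  by apply: (@vanishW n.+1) => //; apply: TB => //; apply: fg.
by apply: vanish_subC; apply: (vanishW (leqnSn n)); apply: fg.
Qed.

Lemma contraction_unique (T : fps K -> fps K) f g :
    (forall n, vanish n (f - g) -> vanish n.+1 (T f - T g)) ->
  T f = f -> T g = g -> f = g.
Proof.
move=> TB Tf Tg; apply: eq_fps_vanish; elim=> [|n IHn]; first exact: vanish0n.
by have := TB n IHn; rewrite Tf Tg.
Qed.

Definition fpsX : fps K := FPS (fun n => (n == 1)%:R).

End Vanishing.
Arguments vanishX {K n} k {f}.

(** * Substitution of power series as a ring morphism *)

Section Composition.
Variable K : comNzRingType.
Implicit Types f g s : fps K.

Definition trunc N f : {poly K} := \poly_(i < N) fps_coef f i.
(** For a polynomial, substitution is a finite evaluation, multiplicative in p; identities for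
    [fps_comp] are reduced to this case modulo each t^N. *)
Definition poly_at (p : {poly K}) s : fps K := (map_poly (@fpsC K) p).[s].

Lemma poly_at_wide N (p : {poly K}) s : (size p <= N)%N ->
  poly_at p s = \sum_(i < N) fpsC p`_i * s ^+ i.
Proof.
move=> le_pN; rewrite /poly_at (@horner_coef_wide _ N) ?(leq_trans (size_poly _ _)) //.
by apply: eq_bigr => i _; rewrite coef_map_id0 // rmorph0.
Qed.

Lemma poly_at_vanish N (p : {poly K}) s : vanish 1 s ->
  (forall i, (i < N)%N -> p`_i = 0) -> vanish N (poly_at p s).
Proof.
move=> s1 p0 n lt_nN; rewrite (poly_at_wide s (leqnn _)) fps_coef_sum big1 // => i _.
rewrite fps_coefCM; have [/p0->|le_Ni] := ltnP i N; first by rewrite mul0r.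
by rewrite (vanishX i s1) ?mulr0 // muln1 (leq_trans lt_nN).
Qed.

Lemma fps_comp_trunc N f s : vanish 1 s ->
  vanish N (fps_comp f s - poly_at (trunc N f) s).
Proof.
move=> s1 n lt_nN; apply/eqP; rewrite fps_coefB subr_eq0; apply/eqP.
rewrite (poly_at_wide s (size_poly N _)) fps_coef_sum [fps_coef (fps_comp _ _) n]/=.
rewrite (big_ord_widen N (fun i => fps_coef f i * fps_coef (s ^+ i) n)) //.
rewrite big_mkcond; apply: eq_bigr => i _; rewrite fps_coefCM coef_poly ltn_ord.
case: ifPn => //; rewrite -leqNgt => lt_ni.
by rewrite (vanishX i s1) ?mulr0 // muln1.
Qed.

Lemma coef_trunc N f i : (i < N)%N -> (trunc N f)`_i = fps_coef f i.
Proof. by move=> lt_iN; rewrite coef_poly lt_iN. Qed.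

Fact fps_comp_is_zmod_morphism s : zmod_morphism (fun f => fps_comp f s).
Proof.
move=> f g; apply/fpsP => n; rewrite fps_coefB /= -sumrB; apply: eq_bigr => i _.
by rewrite -mulrBl.
Qed.

Lemma fps_compC c s : fps_comp (fpsC c) s = fpsC c.
Proof.
apply/fpsP => n /=; rewrite big_ord_recl /= big1 ?addr0 => [|i _]; last first.
  by rewrite mul0r.
by case: n => [|n] /=; rewrite ?mulr1 ?mulr0.
Qed.

(** Modulo t^N both sides are evaluations at s of polynomials, the truncation of the product and the
    product of the truncations, whose coefficients below N agree. *)
Lemma fps_compM f g s : vanish 1 s ->
  fps_comp (f * g) s = fps_comp f s * fps_comp g s.
Proof.
move=> s1; apply: eq_fps_vanish => N.
rewrite -(subrK (poly_at (trunc N f * trunc N g) s) (fps_comp _ s)) -addrA.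
apply: vanishD; last first.
  have ->: poly_at (trunc N f * trunc N g) s =
    poly_at (trunc N f) s * poly_at (trunc N g) s.
    by rewrite /poly_at rmorphM hornerM.
  by apply/vanish_subC/vanish_mul_sub; apply: fps_comp_trunc.
rewrite -(subrK (poly_at (trunc N (f * g)) s) (fps_comp _ s)) -addrA.
apply: vanishD; first exact: fps_comp_trunc.
have ->: poly_at (trunc N (f * g)) s - poly_at (trunc N f * trunc N g) s =
  poly_at (trunc N (f * g) - trunc N f * trunc N g) s.
  by rewrite /poly_at rmorphB hornerD hornerN.
apply: poly_at_vanish => // i lt_iN; rewrite coefB coef_trunc // coefM fps_coefM.
apply/eqP; rewrite subr_eq0; apply/eqP; apply: eq_bigr => k _.
by rewrite !coef_trunc ?(leq_ltn_trans _ lt_iN) ?leq_subr // -ltnS.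
Qed.

(** The proof that s has no constant term is an argument, so that substitution can carry a ring
    morphism structure. *)
Definition comp_at s of vanish 1 s := fun f => fps_comp f s.

Section Morphism.
Variables (s : fps K) (s1 : vanish 1 s).

Fact comp_at_is_zmod_morphism : zmod_morphism (comp_at s1).
Proof. exact: fps_comp_is_zmod_morphism. Qed.

Fact comp_at_is_monoid_morphism : monoid_morphism (comp_at s1).
Proof. by split=> [|f g]; [apply: fps_compC | apply: fps_compM]. Qed.

HB.instance Definition _ := GRing.isZmodMorphism.Build (fps K) (fps K)
  (comp_at s1) comp_at_is_zmod_morphism.
HB.instance Definition _ := GRing.isMonoidMorphism.Build (fps K) (fps K)
  (comp_at s1) comp_at_is_monoid_morphism.

End Morphism.

Lemma fps_comp_poly_at (p : {poly K}) s w : vanish 1 s ->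
  fps_comp (poly_at p w) s = poly_at p (fps_comp w s).
Proof.
move=> s1; rewrite !(poly_at_wide _ (leqnn _)) -[LHS]/(comp_at s1 _) rmorph_sum.
by apply: eq_bigr => i _; rewrite rmorphM rmorphXn /= {1}/comp_at fps_compC.
Qed.

Lemma vanish_comp n f s : vanish n f -> vanish 1 s -> vanish n (fps_comp f s).
Proof.
move=> fn s1 m lt_mn /=; rewrite big1 // => i _.
by rewrite fn ?mul0r // (leq_ltn_trans _ lt_mn) // -ltnS.
Qed.

Lemma vanish_compr n f s : vanish 1 f -> vanish n s -> (0 < n)%N ->
  vanish n (fps_comp f s).
Proof.
move=> f1 sn n_gt0 m lt_mn /=; rewrite big1 // => -[[|i] /= _] _.
  by rewrite f1 ?mul0r.
by rewrite (vanishX i.+1 sn) ?mulr0 // mulSn ltn_addr.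
Qed.

(** Modulo t^N the series f may be replaced by its truncation, and substitution of s commutes with
    polynomial evaluation. *)
Lemma fps_compA f w s : vanish 1 w -> vanish 1 s ->
  fps_comp (fps_comp f w) s = fps_comp f (fps_comp w s).
Proof.
move=> w1 s1; apply: eq_fps_vanish => N.
have ws1 : vanish 1 (fps_comp w s) by apply: vanish_comp.
rewrite -(subrK (poly_at (trunc N f) (fps_comp w s)) (fps_comp (fps_comp _ _) s)).
rewrite -addrA.
apply: vanishD; last first.
  by apply/vanish_subC/fps_comp_trunc.
rewrite -fps_comp_poly_at // -fps_comp_is_zmod_morphism.
by apply: vanish_comp => //; apply: fps_comp_trunc.
Qed.

Lemma fps_compX s : vanish 1 s -> fps_comp (fpsX K) s = s.
Proof.
move=> s1; apply/fpsP => n /=; case: n => [|n].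
  by rewrite big_ord1 mul0r s1.
rewrite !big_ord_recl /= mul0r add0r expr1 mul1r big1 ?addr0 // => i _.
by rewrite mul0r.
Qed.

End Composition.

(** * Orders and division over a field *)

Section Orders.
Variable K : fieldType.
Implicit Types f g s : fps K.

Definition order_is n f : Prop := vanish n f /\ fps_coef f n != 0.

Lemma fps_ordP n f : fps_ord f = Some n <-> order_is n f.
Proof.
rewrite /fps_ord; case: boolp.pselect => [ex_n | no_n]; last first.
  by split=> // -[_ fn]; case: no_n; exists n.
case: ex_minnP => m fm min_m; split=> [[<-] | [fn fn0]].
  by split=> // k; rewrite ltnNge => /negP lt_km; apply/eqP/negPn/negP => /min_m.
congr Some; apply/eqP; rewrite eqn_leq min_m //= leqNgt.
by apply: contraNN fm => /fn ->.
Qed.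

Lemma ole_fps_ord n f : ole (Some n) (fps_ord f) <-> vanish n f.
Proof.
split=> [|fn].
  rewrite /fps_ord; case: boolp.pselect => [ex_n|no_n] /=.
    case: ex_minnP => m fm min_m le_nm k lt_kn; apply/eqP/negPn/negP => /min_m.
    by rewrite leqNgt (leq_trans lt_kn).
  by move=> _ k _; apply/eqP/negPn/negP => fk; apply: no_n; exists k.
case E: (fps_ord f) => [m|] //=; case/fps_ordP: E => fm fm0.
by rewrite leqNgt; apply: contraNN fm0 => /fn ->.
Qed.

Lemma fps_eq0_or_order f : f = 0 \/ exists n, order_is n f.
Proof.
case E: (fps_ord f) => [n|]; first by right; exists n; apply/fps_ordP.
left; apply/eq_fps_vanish => n; rewrite subr0; apply/ole_fps_ord; by rewrite E.
Qed.

Lemma order_is_neq0 n f : order_is n f -> f <> 0.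
Proof. by case=> _ /negP f0 Ef; apply: f0; rewrite Ef. Qed.

Lemma order_is_inj m n f : order_is m f -> order_is n f -> m = n.
Proof. by move=> /fps_ordP + /fps_ordP => -> []. Qed.

Lemma order_isM m n f g : order_is m f -> order_is n g -> order_is (m + n) (f * g).
Proof.
move=> [fm fm0] [gn gn0]; split; first exact: vanishM.
by rewrite fps_coefM_vanish // mulf_neq0.
Qed.

Lemma order_isX n k f : order_is n f -> order_is (k * n) (f ^+ k).
Proof.
move=> fn; elim: k => [|k IHk]; last by rewrite exprS mulSn; apply: order_isM.
by split=> //; rewrite oner_eq0.
Qed.

Lemma order_is0 f : fps_coef f 0 != 0 -> order_is 0 f.
Proof. by split=> //; apply: vanish0n. Qed.

Lemma fps_mulf_eq0 f g : f * g = 0 -> f <> 0 -> g = 0.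
Proof.
move=> fg0 f0; have [//|[n gn]] := fps_eq0_or_order g.
have [//|[m fm]] := fps_eq0_or_order f.
by case: (order_is_neq0 (order_isM fm gn)).
Qed.

Lemma fps_mulfI f g h : f <> 0 -> f * g = f * h -> g = h.
Proof.
move=> f0 /eqP; rewrite -subr_eq0 -mulrBr => /eqP/fps_mulf_eq0 /(_ f0)/eqP.
by rewrite subr_eq0 => /eqP.
Qed.

Definition shift_down m f : fps K := FPS (fun n => fps_coef f (n + m)).

Lemma shift_downK m f : vanish m f -> f = fpsX K ^+ m * shift_down m f.
Proof.
elim: m f => [|m IHm] f fm.
  by rewrite expr0 mul1r; apply/fpsP => n /=; rewrite addn0.
rewrite exprS -mulrA; have ->: shift_down m.+1 f = shift_down m (shift_down 1 f).
  by apply/fpsP => n /=; rewrite -addnA addn1.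
rewrite -IHm; last by move=> k ltkm /=; rewrite fm // addn1.
apply/fpsP => -[|n]; first by rewrite fps_coef0M mul0r fm.
rewrite fps_coefM !big_ord_recl /= mul0r add0r mul1r big1 ?addr0; last first.
  by move=> i _; rewrite mul0r.
by rewrite subn1 addn1.
Qed.

(** Write f = t^m (e + k) with e a nonzero constant and k without constant term. The quotient is the
    fixed point of w = (g / t^m - k w) / e, a contraction because of the factor k. *)
Lemma fps_divide m f g : order_is m f -> vanish m.+1 g ->
  exists2 w, vanish 1 w & g = f * w.
Proof.
move=> [fm fm0] gm; set e := fps_coef f m in fm0.
pose k := shift_down m f - fpsC e.
have k1 : vanish 1 k by apply: vanish1; rewrite fps_coefB /= subrr.
have [||w w1 Ew] := @contraction_fixpoint _
  (fun w => fpsC e^-1 * (shift_down m g - k * w)).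
- move=> w w1; apply: vanishMl; apply: vanishB; last exact: vanishMl.
  by apply: vanish1; apply: gm.
- move=> n w w' w1 w1' ww; rewrite -mulrBr; apply: vanishMl.
  rewrite opprB addrC addrA addrNK -mulrBr -add1n; apply: vanishM => //.
  exact: vanish_subC.
exists w => //; rewrite (shift_downK fm) (shift_downK (vanishW (leqnSn m) gm)).
rewrite -mulrA; congr (_ * _); rewrite -[shift_down m f](subrK (fpsC e)) -/k mulrDl.
by rewrite -{2}Ew mulrA -rmorphM divff // rmorph1 mul1r addrC subrK.
Qed.

End Orders.

(** * The normal form of the affine equation *)

(** The form 1 + U^q + V (V - U)^(q-1) with U = X^(q-1) and V = Y^(q-1); the argument [n] is q -
    1. *)
Definition dgz_normal (R : nzRingType) (n : nat) (X Y : R) : R :=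
  1 + (X ^+ n) ^+ n.+1 + Y ^+ n * (Y ^+ n - X ^+ n) ^+ n.

Section Frobenius.
Variables (R : comNzRingType) (q : nat).
Hypothesis qR : [pchar R].-nat q.
Implicit Types x y : R.

Lemma frobD x y : (x + y) ^+ q = x ^+ q + y ^+ q.
Proof. exact: exprDn_pchar. Qed.

Lemma frobN x : (- x) ^+ q = - x ^+ q.
Proof. exact: exprNn_pchar. Qed.

Lemma frobB x y : (x - y) ^+ q = x ^+ q - y ^+ q.
Proof. by rewrite frobD frobN. Qed.

End Frobenius.

Section NormalForm.
Variables (R : comNzRingType) (n : nat).
Let q := n.+1.
Hypothesis qR : [pchar R].-nat q.
Implicit Types X Y x y z : R.

(** Without the common factor X Y the claim reads (V - U) (1 + U^q) + V (V - U)^q = (V - U) +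
    V^(q+1) - U^(q+1), which follows from (V - U)^q = V^q - U^q. *)
Lemma dgz_normalM X Y :
  dgz_normal n X Y * (X * Y ^+ q - X ^+ q * Y) =
  (X * Y ^+ q - X ^+ q * Y) + (X * Y ^+ (q ^ 2) - X ^+ (q ^ 2) * Y).
Proof.
have E2 x : x ^+ (q ^ 2) = x * (x ^+ n * (x ^+ n) ^+ q).
  by rewrite -exprS -exprM -exprS; congr (_ ^+ _); rewrite /q; nia.
have := frobB qR (Y ^+ n) (X ^+ n); rewrite /dgz_normal !E2 /q ![_ ^+ n.+1]exprS.
set U := X ^+ n; set V := Y ^+ n; set W := (V - U) ^+ n.
set a := U ^+ n; set b := V ^+ n => EW.
transitivity (X * Y * (V - U) + X * Y * (U * a * (V - U) + V * ((V - U) * W))).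
  ring.
rewrite EW; ring.
Qed.

Lemma frob2 x : x ^+ (q ^ 2) = (x ^+ q) ^+ q.
Proof. by rewrite -exprM mulnn. Qed.

Lemma frob3 x : x ^+ (q ^ 3) = ((x ^+ q) ^+ q) ^+ q.
Proof. by rewrite -!exprM; congr (_ ^+ _); rewrite !expnS; nia. Qed.

(** The hypothesis is D_1 = f D_2 in a chart, reduced to 2 by 2 minors. It is rewritten by x^(q^2) -
    x = A + A^q and x^(q^3) - x = A + A^q + A^(q^2), and likewise for y and B. *)
Lemma dgz_minors f x y :
    (x ^+ q - x) * (y ^+ (q ^ 3) - y) - (x ^+ (q ^ 3) - x) * (y ^+ q - y) =
      f * ((x ^+ q - x) * (y ^+ (q ^ 2) - y) - (x ^+ (q ^ 2) - x) * (y ^+ q - y)) ->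
  let A := x ^+ q - x in let B := y ^+ q - y in
  f * (A * B ^+ q - A ^+ q * B) =
  (A * B ^+ q - A ^+ q * B) + (A * B ^+ (q ^ 2) - A ^+ (q ^ 2) * B).
Proof.
move=> E A B; move: E; rewrite {}/A {}/B !frob2 !frob3 !(frobB qR).
move: (x ^+ q) (y ^+ q) => x1 y1; move: (x1 ^+ q) (y1 ^+ q) => x2 y2.
move: (x2 ^+ q) (y2 ^+ q) => x3 y3 E.
transitivity (f * ((x1 - x) * (y2 - y) - (x2 - x) * (y1 - y))); first ring.
by rewrite -E; ring.
Qed.

End NormalForm.

(** An F_q-linear change of (A, B) multiplies both minors by its determinant, so [f] and the normal
    form in the new variables solve the same linear equation, with nonzero coefficient. *)
Lemma dgz_normal_unique (R : idomainType) (n : nat) (f A B a b u v : R) :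
    let q := n.+1 in
    [pchar R].-nat q -> [/\ a ^+ q = a, b ^+ q = b, u ^+ q = u & v ^+ q = v] ->
    a * v - b * u != 0 -> A * B ^+ q - A ^+ q * B != 0 ->
    f * (A * B ^+ q - A ^+ q * B) =
      (A * B ^+ q - A ^+ q * B) + (A * B ^+ (q ^ 2) - A ^+ (q ^ 2) * B) ->
  f = dgz_normal n (a * A + b * B) (u * A + v * B).
Proof.
move=> q qR [aq bq uq vq] d0 D0 fD.
set X := a * A + b * B; set Y := u * A + v * B.
have EX : X ^+ q = a * A ^+ q + b * B ^+ q by rewrite (frobD qR) !exprMn aq bq.
have EY : Y ^+ q = u * A ^+ q + v * B ^+ q by rewrite (frobD qR) !exprMn uq vq.
have EX2 : X ^+ (q ^ 2) = a * A ^+ (q ^ 2) + b * B ^+ (q ^ 2).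
  by rewrite !frob2 EX (frobD qR) !exprMn aq bq.
have EY2 : Y ^+ (q ^ 2) = u * A ^+ (q ^ 2) + v * B ^+ (q ^ 2).
  by rewrite !frob2 EY (frobD qR) !exprMn uq vq.
have E : X * Y ^+ q - X ^+ q * Y = (a * v - b * u) * (A * B ^+ q - A ^+ q * B).
  by rewrite EX EY /X /Y; ring.
have E2 : X * Y ^+ (q ^ 2) - X ^+ (q ^ 2) * Y =
  (a * v - b * u) * (A * B ^+ (q ^ 2) - A ^+ (q ^ 2) * B).
  by rewrite EX2 EY2 /X /Y; ring.
apply: (mulIf (mulf_neq0 d0 D0)); rewrite -E dgz_normalM // E E2 -mulrDr -fD.
by rewrite mulrCA.
Qed.

Lemma det3 (R : comNzRingType) (M : nat -> nat -> R) :
  \det (\matrix_(i < 3, j < 3) M i j) =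
    M 0%N 0%N * (M 1%N 1%N * M 2%N 2%N - M 1%N 2%N * M 2%N 1%N)
  - M 0%N 1%N * (M 1%N 0%N * M 2%N 2%N - M 1%N 2%N * M 2%N 0%N)
  + M 0%N 2%N * (M 1%N 0%N * M 2%N 1%N - M 1%N 1%N * M 2%N 0%N).
Proof.
rewrite (expand_det_row _ ord0) !big_ord_recl big_ord0 /cofactor.
rewrite !(expand_det_row _ ord0) !big_ord_recl !big_ord0 /cofactor !det_mx11 !mxE /=.
by rewrite /bump /=; ring.
Qed.

(** * The DGZ polynomial in an affine chart *)

Section ChartPolynomial.
Variables (K : fieldType) (n : nat).
Let q := n.+1.
Hypothesis qK : [pchar K].-nat q.
Let R := {mpoly K[2]}.

Lemma mpoly_pchar_nat : [pchar R].-nat q.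
Proof.
apply: sub_in_pnat qK => p' _; exact: (rmorph_pchar (@mpolyC 2 K)).
Qed.

Let A (k : 'I_2) : R := 'X_k ^+ q - 'X_k.

(** Row i becomes a row of ones; column subtraction leaves a 2 by 2 minor, with a sign given by the
    position of the row. The exponents [e] stay arbitrary to cover D_1 and D_2 at once. *)
Lemma chart_dgz_det (i : 'I_3) (e : nat -> nat) :
  (\det (\matrix_(m < 3, j < 3) 'X_m ^+ e j) : {mpoly K[3]})
     \mPo [tuple if unlift i m is Some k then 'X_k else 1 | m < 3]
  = (-1) ^+ i * (('X_0 ^+ e 1%N - 'X_0 ^+ e 0%N) * ('X_1 ^+ e 2%N - 'X_1 ^+ e 0%N)
       - ('X_0 ^+ e 2%N - 'X_0 ^+ e 0%N) * ('X_1 ^+ e 1%N - 'X_1 ^+ e 0%N)).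
Proof.
rewrite -det_map_mx.
pose x (m : nat) : R := if m == i then 1 else if m == bump i 0 then 'X_0 else 'X_1.
transitivity (\det (\matrix_(m < 3, j < 3) x m ^+ e j)).
  congr (\det _); apply/matrixP => m j; rewrite !mxE rmorphXn /= comp_mpolyXU.
  rewrite -tnth_nth tnth_mktuple; congr (_ ^+ _).
  rewrite /x; case: unliftP => [k ->|->]; last by rewrite eqxx.
  rewrite -[_ == _ :> nat]/(lift i k == i) eq_sym (negPf (neq_lift _ _)).
  case: k => -[|[|//]] lt_k; rewrite /= ?eqxx.
    by congr 'X_ _; apply/val_inj.
  have -> : (bump i 1 == bump i 0) = false by rewrite /bump; apply/eqP; lia.
  by congr 'X_ _; apply/val_inj.
rewrite (det3 (fun m j => x m ^+ e j)).
by case: i @x => -[|[|[|//]]] lt_i x; rewrite /x /bump /= !expr1n; ring.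
Qed.

Lemma chart_dgz (F : {mpoly K[3]}) (i : 'I_3) : is_dgz_poly q F ->
  chart_poly i F * (A 0 * A 1 ^+ q - A 0 ^+ q * A 1) =
  (A 0 * A 1 ^+ q - A 0 ^+ q * A 1) +
  (A 0 * A 1 ^+ (q ^ 2) - A 0 ^+ (q ^ 2) * A 1).
Proof.
move=> FE.
have := congr1 (comp_mpoly [tuple if unlift i m is Some k then 'X_k else 1 | m < 3]) FE.
rewrite rmorphM /= -/(chart_poly i F) /dgz_D1 /dgz_D2.
rewrite (chart_dgz_det i (fun j => q ^ nth 0 [:: 0; 1; 3] j)%N).
rewrite (chart_dgz_det i (fun j => q ^ nth 0 [:: 0; 1; 2] j)%N) /=.
have qR := mpoly_pchar_nat.
(* The sign (-1)^i stands on both sides; multiplying by it once more removes it. *)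
rewrite mulrCA => /(congr1 ( *%R ((-1) ^+ i))); rewrite !mulrA -!expr2 sqrr_sign !mul1r.
rewrite !expn0 !expn1 !expr1; exact: dgz_minors.
Qed.

End ChartPolynomial.

Lemma rmorph_dgz_normal (R S : nzRingType) (g : {rmorphism R -> S}) n X Y :
  g (dgz_normal n X Y) = dgz_normal n (g X) (g Y).
Proof. by rewrite /dgz_normal !(rmorphB, rmorphD, rmorph1, rmorphM, rmorphXn). Qed.

Lemma artin_schreier_root (K : closedFieldType) (n : nat) (c : K) : (0 < n)%N ->
  exists x : K, x ^+ n.+1 - x = c.
Proof.
case: n => // n _; pose P i : K := if i is j.+1 then (j == 0)%:R else c.
have [x Ex] := @solve_monicpoly K n.+2 P isT; exists x; rewrite Ex.
rewrite !big_ord_recl /= expr0 mulr1 expr1 mul1r big1 ?addr0 ?addrK // => i _.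
by rewrite mul0r.
Qed.

Section ClosedChart.
Variables (K : closedFieldType) (n : nat).
Let q := n.+1.
Hypotheses (qK : [pchar K].-nat q) (n_gt0 : (0 < n)%N).

(** At a point with x^q - x = 1 and y^q - y = x the expression takes the value x^q - x = 1. *)
Lemma dgz_D2_chart_neq0 :
  let A (k : 'I_2) : {mpoly K[2]} := 'X_k ^+ q - 'X_k in is_true
  (A 0 * A 1 ^+ q - A 0 ^+ q * A 1 != 0).
Proof.
have [x Ex] := artin_schreier_root (1 : K) n_gt0.
have [y Ey] := artin_schreier_root x n_gt0.
pose e (k : 'I_2) := if k == 0 then x else y.
move=> A; suff: (A 0 * A 1 ^+ q - A 0 ^+ q * A 1).@[e] != 0.
  by apply: contraNneq => ->; rewrite meval0.
rewrite !(rmorphB, rmorphM, rmorphXn) /= !mevalXU /e /= Ex Ey expr1n !mul1r Ex.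
exact: oner_neq0.
Qed.

(** The cancellation is made between polynomials, where the denominator is nonzero; the resulting
    identity can then be evaluated at any [r]. *)
Lemma series_eval_dgz (F : {mpoly K[3]}) (i : 'I_3) (a b u v : K)
    (r : 'I_2 -> fps K) :
    is_dgz_poly q F ->
    [/\ a ^+ q = a, b ^+ q = b, u ^+ q = u & v ^+ q = v] ->
    a * v - b * u != 0 ->
  let A k := r k ^+ q - r k in
  series_eval (chart_poly i F) r =
  dgz_normal n (fpsC a * A 0 + fpsC b * A 1) (fpsC u * A 0 + fpsC v * A 1).
Proof.
move=> FE [aq bq uq vq] d0 A.
have := @dgz_normal_unique _ n _ _ _ a%:MP b%:MP u%:MP v%:MP
  (mpoly_pchar_nat qK) _ _ dgz_D2_chart_neq0 (chart_dgz qK i FE).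
rewrite -!rmorphXn /= aq bq uq vq => -> //; last first.
  by rewrite -!rmorphM -rmorphB /= mpolyC_eq0.
rewrite /series_eval rmorph_dgz_normal !(rmorphB, rmorphD, rmorphM, rmorphXn) /=.
by rewrite !mmapC !mmapX !mmap1U.
Qed.

End ClosedChart.

(** * The local equation and its solutions *)

Section LocalBranch.
Variables (K : fieldType) (n : nat) (c : K).
Let q := n.+1.
Let k := (q ^ 3 - q)%N.
Hypotheses (qK : [pchar K].-nat q) (n_gt0 : (0 < n)%N).
Hypotheses (c_neq0 : c != 0) (cq : c ^+ q = - c).
Implicit Types x y w s : fps K.

Let qS : [pchar fps K].-nat q.
Proof. by apply: sub_in_pnat qK => p' _; exact: (rmorph_pchar (@fpsC K)). Qed.

Let k_gt0 : (0 < k)%N.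
Proof. by rewrite subn_gt0 /q !expnS; nia. Qed.

Let dX x := x ^+ q - x + fpsC c.
Let dY y := y ^+ q - y.
(** The unit B of the local equation: it is X^q V (V - U)^n with y^n taken out of V = (y^q - y)^n =
    y^n (y^n - 1)^n. *)
Let dB x y := (y ^+ n - 1) ^+ n * dX x ^+ q * (dY y ^+ n - dX x ^+ n) ^+ n.

(** Since c^q = -c, X + X^q = x^(q^2) - x, hence X^q (1 + U^q) = (X + X^q)^q = x^(q^3) - x^q. *)
Lemma dgz_normal_local x y :
  dX x ^+ q * dgz_normal n (dX x) (dY y) = x ^+ q * x ^+ k - x ^+ q + y ^+ n * dB x y.
Proof.
rewrite -exprD subnKC; last by rewrite /q !expnS; nia.
have E : dX x + dX x ^+ q = x ^+ (q ^ 2) - x.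
  rewrite /dX frob2 !(frobD qS, frobN qS) -rmorphXn cq rmorphN /=; ring.
have E2 : dX x ^+ q * (1 + (dX x ^+ n) ^+ q) = x ^+ (q ^ 3) - x ^+ q.
  have -> : dX x ^+ q * (1 + (dX x ^+ n) ^+ q) = (dX x + dX x ^+ q) ^+ q.
    rewrite -{1}(expr1n _ q) -(frobD qS) -exprMn mulrDr mulr1 -exprS //.
  by rewrite E (frobB qS) -exprM -expnSr.
rewrite /dgz_normal mulrDr E2; congr (_ + _).
rewrite /dB !mulrA -exprMn mulrBr mulr1 -exprS -/(dY y).
ring.
Qed.

Let vanish_coef0 x : vanish 1 x -> fps_coef x 0 = 0.
Proof. by move=> x1; apply: x1. Qed.

Lemma order_dX x : vanish 1 x -> order_is 0 (dX x).
Proof.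
move=> /vanish_coef0 x0; apply: order_is0; rewrite /dX fps_coefD fps_coefB fps_coef0X.
by rewrite x0 expr0n /= subr0 add0r.
Qed.

Lemma order_dB x y : vanish 1 x -> vanish 1 y -> order_is 0 (dB x y).
Proof.
move=> x1 /vanish_coef0 y0; have [_ X0] := order_dX x1.
apply: order_is0; rewrite /dB !fps_coef0M !fps_coef0X !mulf_neq0 //.
- rewrite expf_neq0 // fps_coefB fps_coef0X y0 expr0n eqn0Ngt n_gt0 /= sub0r.
  by rewrite oppr_eq0 oner_eq0.
- by rewrite expf_neq0.
rewrite expf_neq0 // fps_coefB !fps_coef0X /dY fps_coefB fps_coef0X y0 subr0.
by rewrite !expr0n eqn0Ngt n_gt0 /= sub0r oppr_eq0 expf_neq0.
Qed.

Lemma order_1subX x : vanish 1 x -> order_is 0 (1 - x ^+ k).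
Proof.
move=> /vanish_coef0 x0; apply: order_is0.
by rewrite fps_coefB fps_coef0X x0 expr0n eqn0Ngt k_gt0 subr0 oner_eq0.
Qed.

(** The blow-up y = x w turns the local equation, divided by x^n, into x = [T w x]. *)
Let T w x := x ^+ k.+1 + w ^+ n * dB x (x * w).

(** In both summands a difference divisible by t^m is multiplied by a series without constant term:
    x or x'^k in the first, w^n in the second. The polynomial expression [dB] preserves congruences
    modulo t^m. *)
Lemma blowup_contraction w m x x' : vanish 1 w -> vanish 1 x -> vanish 1 x' ->
  vanish m (x - x') -> vanish m.+1 (T w x - T w x').
Proof.
move=> w1 x1 x'1 xx'; apply: vanish_add_sub.
  have Ek j : vanish m (x ^+ j - x' ^+ j) by apply: vanish_exp_sub.
  rewrite !exprS; have -> : x * x ^+ k - x' * x' ^+ k =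
    x * (x ^+ k - x' ^+ k) + (x - x') * x' ^+ k by ring.
  apply: vanishD; first by rewrite -add1n; apply: vanishM.
  rewrite -addn1; apply: vanishM => //; apply: (vanishW _ (vanishX k x'1)).
  by rewrite muln1.
rewrite -mulrBr -add1n; apply: vanishM.
  by apply: (vanishW _ (vanishX n w1)); rewrite muln1.
have yy' : vanish m (x * w - x' * w) by rewrite -mulrBl; apply: vanishMr.
have XX' : vanish m (dX x - dX x').
  apply: vanish_add_sub; last by rewrite subrr; apply: vanishn0.
  by apply: vanish_add_sub; [apply: vanish_exp_sub | apply: vanish_opp_sub].
have YY' : vanish m (dY (x * w) - dY (x' * w)).
  by apply: vanish_add_sub; [apply: vanish_exp_sub | apply: vanish_opp_sub].
apply: vanish_mul_sub; first apply: vanish_mul_sub; apply: vanish_exp_sub => //.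
  apply: vanish_add_sub; first exact: vanish_exp_sub.
  by rewrite subrr; apply: vanishn0.
apply: vanish_add_sub; first exact: vanish_exp_sub.
by apply: vanish_opp_sub; apply: vanish_exp_sub.
Qed.

Lemma vanish_T w x : vanish 1 w -> vanish 1 x -> vanish 1 (T w x).
Proof.
move=> w1 x1; apply: vanishD; first by rewrite exprS; apply: vanishMr.
by case: n n_gt0 => // n' _; rewrite exprS -mulrA; apply: vanishMr.
Qed.

Lemma rmorph_T s w x (s1 : vanish 1 s) :
  fps_comp (T w x) s = T (fps_comp w s) (fps_comp x s).
Proof.
rewrite -!/(comp_at s1 _) /T /dB /dX /dY.
rewrite !(rmorphB, rmorphD, rmorphM, rmorphXn, rmorph1) /=.
by rewrite /comp_at !fps_compC.
Qed.

(** The fixed point equation reads x (1 - x^k) = w^n B, where 1 - x^k and B are units, so ord x = n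
    ord w. *)
Lemma order_T w x m : order_is m.+1 w -> vanish 1 x -> T w x = x ->
  order_is (n * m.+1) x.
Proof.
move=> wm x1; have w1 : vanish 1 w by case: wm => wm _; apply: vanishW wm.
move=> Tx; have [x0 | [d xd]] := fps_eq0_or_order x.
  have := order_isM (order_isX n wm) (order_dB x1 (vanishMl x w1)).
  move/order_is_neq0; case; move: Tx; rewrite /T x0 exprS mul0r add0r //.
have E : x * (1 - x ^+ k) = w ^+ n * dB x (x * w).
  by rewrite mulrBr mulr1 -exprS -{1}Tx /T addrC addKr.
have := order_isM xd (order_1subX x1); rewrite E => /order_is_inj/(_ _).
move/(_ _ (order_isM (order_isX n wm) (order_dB x1 (vanishMl x w1)))).
by rewrite !addn0 => <-.
Qed.

Lemma dgz_normal_blowup x w :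
  dX x ^+ q * dgz_normal n (dX x) (dY (x * w)) = x ^+ n * (T w x - x).
Proof. rewrite dgz_normal_local /T !exprMn !exprS; ring. Qed.

(** In x^q (1 - x^k) = y^n B the factors 1 - x^k and B are units. So x and y are both nonzero and q
    ord x = (q - 1) ord y, whence ord y > ord x. *)
Lemma dgz_normal_branch_divides x y : vanish 1 x -> vanish 1 y ->
    ~ (x = 0 /\ y = 0) -> dgz_normal n (dX x) (dY y) = 0 ->
  exists2 w, vanish 1 w & y = x * w.
Proof.
move=> x1 y1 xy0 N0; have := dgz_normal_local x y; rewrite N0 mulr0 => E.
have {}E : x ^+ q * (1 - x ^+ k) = y ^+ n * dB x y.
  by apply/eqP; rewrite -subr_eq0 mulrBr mulr1 -oppr_eq0 E; apply/eqP; ring.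
have O1 := order_1subX x1.
have OB := order_dB x1 y1.
have [x0 | [d xd]] := fps_eq0_or_order x.
  have [y0 | [e ye]] := fps_eq0_or_order y; first by case: xy0.
  have := order_is_neq0 (order_isM (order_isX n ye) OB); case.
  by rewrite -E x0 exprS !mul0r.
have [y0 | [e ye]] := fps_eq0_or_order y.
  have := order_is_neq0 (order_isM (order_isX q xd) O1); case.
  by rewrite E y0 -(prednK n_gt0) exprS !mul0r.
apply: (fps_divide xd); apply: (vanishW _ ye.1).
have := order_isM (order_isX q xd) O1.
rewrite E => /order_is_inj/(_ (order_isM (order_isX n ye) OB)).
have d_gt0 : (0 < d)%N.
  by case: d xd => // -[_]; rewrite (x1 0%N) ?eqxx.
rewrite !addn0 mulSn => Ede; rewrite ltnNge; apply/negP => le_ed.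
have := leq_mul (leqnn n) le_ed; rewrite -Ede -{2}[(n * d)%N]add0n leq_add2r.
by rewrite leqNgt d_gt0.
Qed.

(** The branch is the fixed point of [T] at w = t; any other solution is its composite with the
    ratio w = y' / x'. *)
Lemma dgz_normal_branch : exists x, [/\ order_is n x,
   dgz_normal n (dX x) (dY (x * fpsX K)) = 0 &
   forall x' y', vanish 1 x' -> vanish 1 y' -> ~ (x' = 0 /\ y' = 0) ->
     dgz_normal n (dX x') (dY y') = 0 ->
   exists2 s, vanish 1 s & x' = fps_comp x s /\ y' = fps_comp (x * fpsX K) s].
Proof.
have t1 : vanish 1 (fpsX K) by apply: vanish1.
have tO : order_is 1 (fpsX K) by split=> //; apply: oner_neq0.
have [||x x1 Tx] := @contraction_fixpoint _ (T (fpsX K)).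
- by move=> x; apply: vanish_T.
- by move=> m x x' x1 x'1; apply: blowup_contraction.
have dX0 x' : vanish 1 x' -> dX x' ^+ q <> 0.
  by move=> x'1; apply: order_is_neq0 (order_isX q (order_dX x'1)).
exists x; split.
- by rewrite -[n]muln1; apply: order_T Tx.
- have := dgz_normal_blowup x (fpsX K); rewrite Tx subrr mulr0.
  by move/fps_mulf_eq0; apply; apply: dX0.
move=> x' y' x'1 y'1 xy0 N0.
have [w w1 Ey] := dgz_normal_branch_divides x'1 y'1 xy0 N0.
have x'_neq0 : x' <> 0 by move=> x'0; apply: xy0; rewrite Ey x'0 mul0r.
have Tx' : T w x' = x'.
  have := dgz_normal_blowup x' w; rewrite -Ey N0 mulr0 => /esym/fps_mulf_eq0.
  move=> /(_ _)/eqP; rewrite subr_eq0 => E; apply/eqP/E.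
  have [//|[d xd]] := fps_eq0_or_order x'; exact: order_is_neq0 (order_isX n xd).
(* Substituting w for t in the fixed point equation of x makes x(w) a fixed point of [T w], as x'
   is; a contraction has only one. *)
have E : x' = fps_comp x w.
  apply: (@contraction_unique _ (T w)) => //.
    by move=> m; apply: blowup_contraction => //; apply: vanish_comp.
  by have := rmorph_T (fpsX K) x w1; rewrite Tx (fps_compX w1) => <-.
by exists w => //; rewrite (fps_compM _ _ w1) (fps_compX w1) -E.
Qed.

End LocalBranch.

(** * Branches at a point of PG(2, q^2) \ PG(2, q) *)

Section OrderComp.
Variable K : fieldType.
Implicit Types f g s : fps K.

Lemma order_is_comp m f s :
  order_is m f -> order_is 1 s -> order_is m (fps_comp f s).
Proof.
move=> [fm fm0] s1; split; first by apply: vanish_comp s1.1.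
rewrite /= big_ord_recr /= big1 ?add0r => [|i _]; last by rewrite fm ?mul0r.
by have [_] := order_isX m s1; rewrite muln1; apply: mulf_neq0.
Qed.

Lemma olt_fps_ord n f : olt (Some n) (fps_ord f) <-> vanish n.+1 f.
Proof.
by rewrite -ole_fps_ord /olt; case: (fps_ord f) => [m|] //=; rewrite ltnNge.
Qed.

Lemma omin_fps_ord n f g : vanish n f -> vanish n g ->
  fps_coef f n != 0 \/ fps_coef g n != 0 -> omin (fps_ord f) (fps_ord g) = Some n.
Proof.
move=> fn gn; rewrite /omin => -[f0|g0].
  have/fps_ordP -> : order_is n f by [].
  by move/ole_fps_ord: gn => ->.
have/fps_ordP -> : order_is n g by [].
move/ole_fps_ord: fn; case: (fps_ord f) => [m|] //= le_nm.
by case: ifP => // le_mn; congr Some; apply/eqP; rewrite eqn_leq le_mn.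
Qed.

End OrderComp.

(** * From local coordinates to branches and tangents *)

Section AffineBranch.
Variables (K : fieldType) (n : nat) (f : {mpoly K[2]}) (a : 'I_2 -> K).
Variables al be u v c : K.
Let q := n.+1.
Let delta := al * v - be * u.
Hypotheses (qK : [pchar K].-nat q) (n_gt0 : (0 < n)%N).
Hypotheses (c_neq0 : c != 0) (cq : c ^+ q = - c) (delta_neq0 : delta != 0).
Implicit Types (r : 'I_2 -> fps K) (s x y : fps K).

(** Local coordinates at the point: [eta] = 0 will be the tangent and [xi] is transversal to it. All
    that is used about f is the normal form [fE]. *)
Let xi r := fpsC al * (r 0 - fpsC (a 0)) + fpsC be * (r 1 - fpsC (a 1)).
Let eta r := fpsC u * (r 0 - fpsC (a 0)) + fpsC v * (r 1 - fpsC (a 1)).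
Let normal x y := dgz_normal n (x ^+ q - x + fpsC c) (y ^+ q - y).
Hypothesis fE : forall r, (forall k, fps_coef (r k) 0 = a k) ->
  series_eval f r = normal (xi r) (eta r).

(** The inverse of the change of coordinates to ([xi], [eta]), by Cramer's rule. *)
Let point x y : 'I_2 -> fps K := fun k => fpsC (a k) +
  fpsC delta^-1 * (if k == 0 then fpsC v * x - fpsC be * y
                   else fpsC al * y - fpsC u * x).

Let deltaK : fpsC delta^-1 * (fpsC al * fpsC v - fpsC be * fpsC u) = 1.
Proof. by rewrite -!rmorphM -rmorphB -rmorphM mulVf // rmorph1. Qed.

Let xi_point x y : xi (point x y) = x.
Proof.
rewrite /xi /point /= !(addrC (fpsC (a _))) !addrK -[RHS]mul1r -deltaK; ring.
Qed.

Let eta_point x y : eta (point x y) = y.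
Proof.
rewrite /eta /point /= !(addrC (fpsC (a _))) !addrK -[RHS]mul1r -deltaK; ring.
Qed.

Let subr_point r k : r k - fpsC (a k) =
  fpsC delta^-1 * (if k == 0 then fpsC v * xi r - fpsC be * eta r
                   else fpsC al * eta r - fpsC u * xi r).
Proof.
rewrite -[LHS]mul1r -deltaK /xi /eta; case: k => -[|[|//]] lt_k /=.
  have -> : Ordinal lt_k = 0 by apply/val_inj.
  ring.
have -> : Ordinal lt_k = 1 by apply/val_inj.
ring.
Qed.

Let pointK r : r =1 point (xi r) (eta r).
Proof. by move=> k; rewrite /point -subr_point addrC subrK. Qed.

Let xi_sub r s : vanish 1 s -> xi (substitution r s) = fps_comp (xi r) s.
Proof.
move=> s1; rewrite -[RHS]/(comp_at s1 _) /xi !(rmorphB, rmorphD, rmorphM) /=.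
by rewrite /comp_at !fps_compC.
Qed.

Let eta_sub r s : vanish 1 s -> eta (substitution r s) = fps_comp (eta r) s.
Proof.
move=> s1; rewrite -[RHS]/(comp_at s1 _) /eta !(rmorphB, rmorphD, rmorphM) /=.
by rewrite /comp_at !fps_compC.
Qed.

Let eq_xi r r' : r =1 r' -> xi r = xi r'.
Proof. by move=> E; rewrite /xi !E. Qed.

Let eq_eta r r' : r =1 r' -> eta r = eta r'.
Proof. by move=> E; rewrite /eta !E. Qed.

Let eq_coords r r' : xi r = xi r' -> eta r = eta r' -> r =1 r'.
Proof. by move=> E1 E2 k; rewrite pointK E1 E2 -pointK. Qed.

Lemma representation_coords r : representation f a r ->
  [/\ vanish 1 (xi r), vanish 1 (eta r), ~ (xi r = 0 /\ eta r = 0)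
    & normal (xi r) (eta r) = 0].
Proof.
move=> [[k rk] r0 fr0]; rewrite -fE //.
have rv j : vanish 1 (r j - fpsC (a j)).
  by apply: vanish1; rewrite fps_coefB r0 subrr.
split=> //; try by apply: vanishD; apply: vanishMl.
move=> [x0 y0]; apply: (rk (a k)); apply/eqP; rewrite -subr_eq0 subr_point x0 y0.
by rewrite !mulr0 subrr if_same mulr0.
Qed.

Lemma coords_representation x y : vanish 1 x -> vanish 1 y ->
  ~ (x = 0 /\ y = 0) -> normal x y = 0 -> representation f a (point x y).
Proof.
move=> x1 y1 xy0 N0.
have coef0 k : fps_coef (point x y k) 0 = a k.
  rewrite /point fps_coefD (_ : fps_coef (_ * _) 0 = 0) ?addr0 //.
  have : vanish 1 (if k == 0 then fpsC v * x - fpsC be * y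
                   else fpsC al * y - fpsC u * x).
    by case: ifP => _; apply: vanishB; apply: vanishMl.
  by move=> H; apply: (@vanishMl _ 1 _ _ H 0).
split; [| exact: coef0 | by rewrite (fE coef0) xi_point eta_point].
have const k d : point x y k = fpsC d -> point x y k - fpsC (a k) = 0.
  by move=> E; rewrite -(coef0 k) E subrr.
have [E0|N_0] := eqVneq (point x y 0 - fpsC (a 0)) 0; last first.
  by exists 0 => d /const/eqP; rewrite (negPf N_0).
exists 1 => d /const E1; apply: xy0.
split; [rewrite -(xi_point x y) | rewrite -(eta_point x y)];
  by rewrite /xi /eta E0 E1 !mulr0 addr0.
Qed.

(** The local solution is transported by [point]; the relation [eta] = [xi] t is kept because it
    recovers the parameter from the branch. *)
Lemma universal_branch : exists r0,
  [/\ representation f a r0, order_is n (xi r0), order_is n.+1 (eta r0),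
      eta r0 = xi r0 * fpsX K &
      forall r, representation f a r ->
        exists2 s, vanish 1 s & r =1 substitution r0 s].
Proof.
have [x [xn N0 univ]] := dgz_normal_branch qK n_gt0 c_neq0 cq.
have tO : order_is 1 (fpsX K) by split; [apply: vanish1 | apply: oner_neq0].
have x1 : vanish 1 x by apply: (vanishW n_gt0); case: xn.
exists (point x (x * fpsX K)); rewrite xi_point eta_point; split=> //.
- apply: coords_representation => //; first exact: vanishMr.
  by move=> [x0 _]; apply: order_is_neq0 xn x0.
- by rewrite -addn1; apply: order_isM.
move=> r /representation_coords[x'1 y'1 xy'0 /(univ _ _ x'1 y'1 xy'0)].
move=> [s s1 [Ex Ey]]; exists s => //.
by apply: eq_coords; rewrite ?xi_sub ?eta_sub ?xi_point ?eta_point.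
Qed.

(** A substitution of order at least 2 into [r0] would contradict the primitivity of r. *)
Let primitive_order r0 r : representation f a r0 ->
    (forall r', representation f a r' ->
        exists2 s, vanish 1 s & r' =1 substitution r0 s) ->
    primitive_representation f a r ->
  exists2 s, order_is 1 s & r =1 substitution r0 s.
Proof.
move=> rep0 univ [/univ[s s1 Er] prim]; exists s => //; split=> //.
apply/eqP => s_1; apply: (prim r0 s rep0) => //; apply/ole_fps_ord.
by move=> [|[|//]] _ //; apply: s1.
Qed.

(** If r0 = r'(s) with ord s >= 2, universality gives r' = r0(s'), so r0 is unchanged by
    substituting s'(s). Comparing the ratio [eta] / [xi] = t yields t = s'(s), of order at least 2,
    a contradiction. *)
Lemma primitive_universal r0 : representation f a r0 -> xi r0 <> 0 ->
    eta r0 = xi r0 * fpsX K ->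
    (forall r', representation f a r' ->
        exists2 s, vanish 1 s & r' =1 substitution r0 s) ->
  primitive_representation f a r0.
Proof.
move=> rep0 xi0 E univ; split=> // r' s /univ[s' s'1 Er'] /ole_fps_ord s2 Er.
have s1 := vanishW (isT : 1 <= 2)%N s2.
have ss1 : vanish 1 (fps_comp s' s) by apply: vanish_comp.
have Ex : xi r0 = fps_comp (xi r0) (fps_comp s' s).
  by rewrite {1}(eq_xi Er) xi_sub // (eq_xi Er') xi_sub // (fps_compA _ s'1 s1).
have Ey : eta r0 = fps_comp (eta r0) (fps_comp s' s).
  by rewrite {1}(eq_eta Er) eta_sub // (eq_eta Er') eta_sub // (fps_compA _ s'1 s1).
move: Ey; rewrite E fps_compM // fps_compX // -Ex => /(fps_mulfI xi0) Et.
have /(_ 1%N isT) : vanish 2 (fps_comp s' s) by apply: vanish_compr.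
by rewrite -Et => /eqP; rewrite oner_eq0.
Qed.

(** The coefficient of [xi] vanishes exactly when the line is parallel to [eta] = 0. *)
Let intersection_coords r l : on_line l a ->
  fpsC l.1.1 * r 0 + fpsC l.1.2 * r 1 + fpsC l.2 =
  fpsC delta^-1 * (fpsC (l.1.1 * v - l.1.2 * u) * xi r
                   + fpsC (l.1.2 * al - l.1.1 * be) * eta r).
Proof.
move=> /eqP; rewrite addrC addr_eq0 => /eqP ->.
transitivity (fpsC l.1.1 * (r 0 - fpsC (a 0)) + fpsC l.1.2 * (r 1 - fpsC (a 1))).
  by rewrite rmorphN rmorphD !rmorphM /=; ring.
by rewrite !subr_point /= !rmorphB !rmorphM /=; ring.
Qed.

(** As ord [xi] = n < ord [eta], a line through the point meets the branch with number n unless its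
    coefficient of [xi] vanishes; this leaves only the line [eta] = 0, with number n + 1. *)
Lemma tangent_coords r : order_is n (xi r) -> order_is n.+1 (eta r) ->
  branch_order a r = Some n /\
  exists2 l, tangent a r l & intersection_number r l = Some q.
Proof.
move=> [xn xn0] yO; have [yn yn0] := yO.
have yn' := vanishW (leqnSn n) yn.
have uv0 : u != 0 \/ v != 0.
  have [u0|] := eqVneq u 0; last by left.
  by right; apply: contraNneq delta_neq0 => v0; rewrite /delta u0 v0 !mulr0 subr0.
(* The affine coordinates contain [xi] with coefficients proportional to v and -u, one of which is
   nonzero. *)
have bo : branch_order a r = Some n.
  rewrite /branch_order !subr_point /=.
  apply: omin_fps_ord; try by apply: vanishMl; apply: vanishB; apply: vanishMl.
  rewrite !fps_coefCM !fps_coefB !fps_coefCM (yn n) // !mulr0 subr0 sub0r.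
  rewrite !(mulf_eq0, invr_eq0, oppr_eq0, negb_or) delta_neq0 xn0 !andbT /=.
  by case: uv0; [right | left].
have exceeds l : exceeds_order a r l <->
    [/\ is_line l, on_line l a & l.1.1 * v = l.1.2 * u].
  split=> [] [l1 l2 l3]; split=> //; move: l3.
    rewrite bo => /olt_fps_ord/(_ n (ltnSn n)); rewrite intersection_coords //.
    rewrite fps_coefCM fps_coefD !fps_coefCM (yn n) // mulr0 addr0.
    move/eqP; rewrite !mulf_eq0 invr_eq0 (negPf delta_neq0) (negPf xn0) orbF /=.
    by rewrite subr_eq0 => /eqP.
  move=> E; rewrite bo; apply/olt_fps_ord; rewrite intersection_coords // E subrr.
  by rewrite rmorph0 mul0r add0r; do 2!apply: vanishMl.
pose l0 : K * K * K := (u, v, - (u * a 0 + v * a 1)).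
have on0 : on_line l0 a by rewrite /on_line /= subrr.
split=> //; exists l0.
  split=> [|[[l1 l2] l3] /exceeds[/= line on /= E]].
    apply/exceeds; split=> //; last by rewrite /= mulrC.
    by case: uv0 => uv0; rewrite /is_line /= uv0 ?orbT.
  have {on} El3 : l3 = - (l1 * a 0 + l2 * a 1).
    by apply/eqP; rewrite -addr_eq0 addrC; apply/eqP.
  have [d [El1 El2]] : exists d, l1 = d * u /\ l2 = d * v.
    case: uv0 => [u0|v0].
      by exists (l1 / u); rewrite divfK // mulrAC E mulfK.
    by exists (l2 / v); rewrite divfK // mulrAC -E mulfK.
  exists d; last by rewrite El3 El1 El2 /=; congr (_, _, _); ring.
  apply/eqP => d0; move: line; rewrite /is_line /= El1 El2 d0 !mul0r eqxx //.
apply/fps_ordP; rewrite intersection_coords //= (mulrC u) subrr rmorph0 mul0r add0r.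
rewrite mulrA -rmorphM /= (mulrC v) (mulrC u) mulVf // rmorph1 mul1r //.
Qed.

(** Each primitive representation is [r0] reparametrized by a series of order 1, which preserves the
    orders of [xi] and [eta]. *)
Lemma unique_branch :
  (exists2 r, primitive_representation f a r &
     forall r', primitive_representation f a r' -> same_branch r r') /\
  (forall r, primitive_representation f a r ->
     branch_order a r = Some n /\
     exists2 l, tangent a r l & intersection_number r l = Some q).
Proof.
have [r0 [rep0 xn yn E univ]] := universal_branch.
split.
  exists r0; first by apply: primitive_universal => //; apply: order_is_neq0 xn.
  by move=> r' /(primitive_order rep0 univ)[s sO Er]; exists s => //; apply/fps_ordP.
move=> r /(primitive_order rep0 univ)[s sO Er]; have [s1 _] := sO.
apply: tangent_coords.
  by rewrite (eq_xi Er) xi_sub //; apply: order_is_comp.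
by rewrite (eq_eta Er) eta_sub //; apply: order_is_comp.
Qed.

End AffineBranch.

(** * Rationality over finite fields and the line over F_q through the point *)

Lemma frob_fixedP (L : finFieldType) (K : fieldType) (j : {rmorphism L -> K})
  (x : K) : x ^+ #|L| = x -> exists y, x = j y.
Proof.
move=> xL; have /(congr1 (fun Q => (map_poly j Q).[x])) := finField_genPoly L.
rewrite rmorphB /= map_polyXn map_polyX hornerD hornerN hornerXn hornerX xL subrr.
rewrite rmorph_prod horner_prod => /esym/eqP/prodf_eq0[y _].
by rewrite rmorphB /= map_polyX map_polyC hornerXsubC subr_eq0 => /eqP; exists y.
Qed.

Lemma chart_point_frob (L : finFieldType) (K : fieldType) (j : {rmorphism L -> K})
    (P : 'rV[K]_3) (i : 'I_3) k :
  in_PG2 j P -> chart_point i P k ^+ #|L| = chart_point i P k.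
Proof.
move=> [v _ [d d0 ->]]; rewrite /chart_point !mxE -mulf_div divff // mul1r.
by rewrite -fmorphV -rmorphM -rmorphXn expf_card.
Qed.

Lemma in_PG2_chart (L : finFieldType) (K : fieldType) (j : {rmorphism L -> K})
    (P : 'rV[K]_3) (i : 'I_3) : P 0 i != 0 ->
  (forall k, chart_point i P k ^+ #|L| = chart_point i P k) -> in_PG2 j P.
Proof.
move=> Pi aL; have [e Ee] : exists e : 'I_2 -> L, forall k, chart_point i P k = j (e k).
  have [e0 E0] := frob_fixedP j (aL 0); have [e1 E1] := frob_fixedP j (aL 1).
  exists (fun k => if k == 0 then e0 else e1) => -[[|[|//]] lt_k] /=.
    by rewrite -E0; congr chart_point; apply/val_inj.
  by rewrite -E1; congr chart_point; apply/val_inj.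
exists (\row_m if unlift i m is Some k then e k else 1).
  apply/eqP => /rowP/(_ i)/eqP; rewrite !mxE unlift_none; exact/negP/oner_neq0.
exists (P 0 i) => //; apply/rowP => m; rewrite !mxE.
case: unliftP => [k ->|->]; last by rewrite rmorph1 mulr1.
by rewrite -Ee /chart_point mulrC divfK.
Qed.

(* The line [u (x - a_0) + v (y - a_1) = 0] is the line over F_q through the
   point and its Frobenius conjugate; [al x + be y] is a transversal coordinate. *)
Lemma rational_line (K : fieldType) (q : nat) (A B : K) :
    [pchar K].-nat q -> (0 < q)%N ->
    A ^+ q = - A -> B ^+ q = - B -> ~ (A = 0 /\ B = 0) ->
  exists al be u v : K,
   [/\ [/\ al ^+ q = al, be ^+ q = be, u ^+ q = u & v ^+ q = v],
       al * v - be * u != 0, u * A + v * B = 0, al * A + be * B != 0 &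
       (al * A + be * B) ^+ q = - (al * A + be * B)].
Proof.
move=> qK q_gt0 Aq Bq AB0; have Z : (0 : K) ^+ q = 0 by rewrite expr0n eqn0Ngt q_gt0.
have [A0|A0] := eqVneq A 0.
  exists 0, 1, 1, 0; rewrite !mul0r !mul1r !add0r addr0 Z expr1n; split=> //.
    by rewrite oppr_eq0 oner_eq0.
  by apply/eqP => B0; apply: AB0.
(* Frobenius changes the sign of both A and B, so it fixes B / A. *)
exists 1, 0, (B / A), (- 1); rewrite !mul0r !mul1r subr0 addr0 Z expr1n; split=> //.
- split=> //; first by rewrite exprMn exprVn Aq Bq invrN mulrNN.
  by rewrite (frobN qK) expr1n.
- by rewrite oppr_eq0 oner_eq0.
- by rewrite divfK // mulN1r subrr.
Qed.

(** The left side is z^q - z for z = b x + d y, and z differs from [l] by the constant b a0 + d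
    a1. *)
Lemma frob_sub_line (K : fieldType) (q : nat) (b d a0 a1 : K) (x y : fps K) :
    [pchar K].-nat q -> b ^+ q = b -> d ^+ q = d ->
  let l := fpsC b * (x - fpsC a0) + fpsC d * (y - fpsC a1) in
  fpsC b * (x ^+ q - x) + fpsC d * (y ^+ q - y) =
  l ^+ q - l + fpsC (b * (a0 ^+ q - a0) + d * (a1 ^+ q - a1)).
Proof.
move=> qK bq dq l; have qS : [pchar fps K].-nat q.
  by apply: sub_in_pnat qK => p' _; exact: (rmorph_pchar (@fpsC K)).
rewrite /l (frobD qS) !exprMn !(frobB qS) -!rmorphXn bq dq.
by rewrite rmorphD !rmorphM !rmorphB /=; ring.
Qed.

Theorem lemma4p6 (p h q : nat) (Fq Fq2 : finFieldType) (K : closedFieldType)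
    (iota : {rmorphism Fq -> K}) (iota2 : {rmorphism Fq2 -> K})
    (F : {mpoly K[3]})
    (p_prime : prime p) (def_q : q = (p ^ h)%N) (q_ge3 : (3 <= q)%N)
    (card_Fq : #|Fq| = q) (card_Fq2 : #|Fq2| = (q ^ 2)%N)
    (K_algebraic : forall x : K, algebraicOver iota x)
    (F_dgz : is_dgz_poly q F)
    (P : 'rV[K]_3) (P_on_curve : F.@[fun i => P 0 i] = 0)
    (P_Fq2 : in_PG2 iota2 P) (P_not_Fq : ~ in_PG2 iota P)
    (i : 'I_3) (P_in_chart : P 0 i != 0) :
  let f := chart_poly i F in
  let a := chart_point i P in
  (exists2 r, primitive_representation f a r &
     forall r', primitive_representation f a r' -> same_branch r r') /\
  (forall r, primitive_representation f a r ->
     branch_order a r = Some q.-1 /\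
     exists2 l, tangent a r l & intersection_number r l = Some q).
Proof.
have qK : [pchar K].-nat q.
  have pL : p \in [pchar Fq].
    by apply: (card_finPcharP _ p_prime); rewrite card_Fq def_q.
  by rewrite (eq_pnat _ (pcharf_eq (rmorph_pchar iota pL))) def_q pnatX pnat_id.
have aq2 k := chart_point_frob i k P_Fq2; rewrite card_Fq2 in aq2.
have not_aq : ~ (forall k, chart_point i P k ^+ q = chart_point i P k).
  by rewrite -card_Fq => /(in_PG2_chart iota P_in_chart).
case: q => // n in def_q q_ge3 card_Fq card_Fq2 F_dgz qK aq2 not_aq *.
have n_gt0 : (0 < n)%N by apply: ltnW.
(* These differences measure the failure of rationality over F_q; a_k^(q^2) = a_k gives A_k^q =
   -A_k. *)
move=> f a; pose A k := a k ^+ n.+1 - a k.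
have Aq k : A k ^+ n.+1 = - A k.
  by rewrite (frobB qK) -frob2 aq2 opprB.
have A_neq0 : ~ (A 0 = 0 /\ A 1 = 0).
  move=> [/eqP A0 /eqP A1]; apply: not_aq => k; apply/eqP; rewrite -subr_eq0.
  case: k => -[|[|//]] lt_k.
    by rewrite (_ : Ordinal _ = 0) //; apply/val_inj.
  by rewrite (_ : Ordinal _ = 1) //; apply/val_inj.
have [al [be [u [v [fixed delta0 lineA c0 cq]]]]] :=
  rational_line qK isT (Aq 0) (Aq 1) A_neq0.
apply: (unique_branch qK n_gt0 c0 cq delta0) => r r_a.
rewrite /f (series_eval_dgz qK n_gt0 i r F_dgz fixed delta0).
have [al_q be_q uq vq] := fixed.
have Ex := frob_sub_line (a 0) (a 1) (r 0) (r 1) qK al_q be_q.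
have Ey := frob_sub_line (a 0) (a 1) (r 0) (r 1) qK uq vq.
apply: (congr2 (dgz_normal n) Ex); apply: (etrans Ey).
(* The constant attached to [eta] vanishes since its line is rational over F_q. *)
by rewrite -/(A 0) -/(A 1) lineA rmorph0 addr0.
Qed.
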